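(* Let $$B=\Big[\mathrm{stack}_{1\le i\le m}\big\{\mathrm{stack}_{1\le j\le n_i}(B_{ij})\big\}\ \Big|\ \mathrm{blockdiag}_{1\le i\le m}\big\{\big[\mathrm{stack}_{1\le j\le n_i}(\dot B_{ij})\ \big|\ \mathrm{blockdiag}_{1\le j\le n_i}(\ddot B_{ij})\big]\big\}\Big],\qquad b=\mathrm{stack}_{1\le i\le m}\big\{\mathrm{stack}_{1\le j\le n_i}(b_{ij})\big\},$$ where, for $1\le i\le m$, $1\le j\le n_i$, $B_{ij}$ is $o_{ij}\times p$, $\dot B_{ij}$ is $o_{ij}\times q_1$, $\ddot B_{ij}$ is $o_{ij}\times q_2$ and $b_{ij}$ is $o_{ij}\times1$. Suppose that $B$ has full (column) rank, and let $A=B^TB$ and $a=B^Tb$. Carry out the following steps. 1. For $i=1,\ldots,m$: (a) For $j=1,\ldots,n_i$: decompose $\ddot B_{ij}=Q_{ij}\begin{bmatrix}R_{ij}\\ O\end{bmatrix}$ such that $Q_{ij}^{-1}=Q_{ij}^T$ and $R_{ij}$ is a $q_2\times q_2$ upper-triangular matrix. Let $d_{0ij}=Q_{ij}^Tb_{ij}$, $D_{0ij}=Q_{ij}^TB_{ij}$, $\dot D_{0ij}=Q_{ij}^T\dot B_{ij}$; let $d_{1ij}$, $D_{1ij}$, $\dot D_{1ij}$ be the first $q_2$ rows of $d_{0ij}$, $D_{0ij}$, $\dot D_{0ij}$, respectively, and $d_{2ij}$, $D_{2ij}$, $\dot D_{2ij}$ the respective remaining rows. (b) Decompose $\mathrm{stack}_{1\le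 j\le n_i}(\dot D_{2ij})=Q_i\begin{bmatrix}R_i\\ O\end{bmatrix}$ such that $Q_i^{-1}=Q_i^T$ and $R_i$ is a $q_1\times q_1$ upper-triangular matrix. Let $c_{0i}=Q_i^T\{\mathrm{stack}_{1\le j\le n_i}(d_{2ij})\}$ and $C_{0i}=Q_i^T\{\mathrm{stack}_{1\le j\le n_i}(D_{2ij})\}$; let $c_{1i}$, $C_{1i}$ be the first $q_1$ rows of $c_{0i}$, $C_{0i}$, respectively, and $c_{2i}$, $C_{2i}$ the respective remaining rows. 2. Decompose $\mathrm{stack}_{1\le i\le m}(C_{2i})=Q\begin{bmatrix}R\\ O\end{bmatrix}$ such that $Q^{-1}=Q^T$ and $R$ is a $p\times p$ upper-triangular matrix, and let $c$ be the first $p$ rows of $Q^T\{\mathrm{stack}_{1\le i\le m}(c_{2i})\}$. Then the solution $x$ of $Ax=a$, and the sub-blocks of $A^{-1}$ named in the context, are given by $$x_1=R^{-1}c,\qquad A^{11}=R^{-1}R^{-T};$$ for $1\le i\le m$, $$x_{2,i}=R_i^{-1}(c_{1i}-C_{1i}\,x_1),\qquad A^{12,i}=-A^{11}\left(R_i^{-1}C_{1i}\right)^T,\qquad A^{22,i}=R_i^{-1}\left(R_i^{-T}-C_{1i}\,A^{12,i}\right);$$ and, for $1\le i\le m$, $1\le j\le n_i$, $$x_{2,ij}=R_{ij}^{-1}\left(d_{1ij}-D_{1ij}\,x_1-\dot D_{1ij}\,x_{2,i}\right),$$ $$A^{12,ij}=-\left\{R_{ij}^{-1}\left(D_{1ij}\,A^{11}+\dot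 D_{1ij}\,(A^{12,i})^T\right)\right\}^T,$$ $$A^{12,\,i,\,j}=-\left\{R_{ij}^{-1}\left(D_{1ij}\,A^{12,i}+\dot D_{1ij}\,A^{22,i}\right)\right\}^T,$$ $$A^{22,ij}=R_{ij}^{-1}\left(R_{ij}^{-T}-D_{1ij}\,A^{12,ij}-\dot D_{1ij}\,A^{12,\,i,\,j}\right).$$ Moreover, writing $\pi(M)$ for the product of the diagonal entries of a square matrix $M$, the determinant of $A$ is $$|A|=\left[\pi(R)\prod_{i=1}^m\left\{\pi(R_i)\prod_{j=1}^{n_i}\pi(R_{ij})\right\}\right]^2.$$
   Context: All matrices and vectors are real; $m,p,q_1,q_2$, the $n_i$ and the $o_{ij}$ are positive integers. $O$ denotes a zero matrix (possibly with no rows) of appropriate size; $M^{-T}=(M^{-1})^T$; $|M|$ is the determinant of a square matrix $M$. For matrices $M_1,\ldots,M_d$ with the same number of columns, $\mathrm{stack}_{1\le i\le d}(M_i)$ is the matrix obtained by placing $M_1,\ldots,M_d$ vertically on top of each other in that order; $\mathrm{blockdiag}_{1\le i\le d}(M_i)$ is the block diagonal matrix with (possibly rectangular) diagonal blocks $M_1,\ldots,M_d$; and $[M\,|\,N]$ is horizontal concatenation. Dots over letters are part of the names of matrices (not derivatives). The matrix $A=B^TB$ is symmetric and has the three-level sparse form $A=\begin{bmatrix}A_{11}&A_{12}\\ A_{12}^T&A_{22}\end{bmatrix}$, where $A_{11}$ is $p\times p$, $A_{12}$ is the horizontal concatenation over $i=1,\ldots,m$ of $[A_{12,i}\,|\,A_{12,i1}\,|\cdots|\,A_{12,in_i}]$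 with $A_{12,i}$ being $p\times q_1$ and $A_{12,ij}$ being $p\times q_2$, and $$A_{22}=\mathrm{blockdiag}_{1\le i\le m}\begin{bmatrix}A_{22,i}&A_{12,\,i,\,1}&\cdots&A_{12,\,i,\,n_i}\\ A_{12,\,i,\,1}^T&A_{22,i1}&\cdots&O\\ \vdots&\vdots&\ddots&\vdots\\ A_{12,\,i,\,n_i}^T&O&\cdots&A_{22,in_i}\end{bmatrix}$$ with $A_{22,i}$ being $q_1\times q_1$, $A_{12,\,i,\,j}$ being $q_1\times q_2$ and $A_{22,ij}$ being $q_2\times q_2$. Explicitly, $A_{11}=\sum_{i}\sum_{j}B_{ij}^TB_{ij}$, $A_{12,i}=\sum_{j}B_{ij}^T\dot B_{ij}$, $A_{22,i}=\sum_{j}\dot B_{ij}^T\dot B_{ij}$, $A_{12,ij}=B_{ij}^T\ddot B_{ij}$, $A_{12,\,i,\,j}=\dot B_{ij}^T\ddot B_{ij}$, $A_{22,ij}=\ddot B_{ij}^T\ddot B_{ij}$. Note that $A_{12,ij}$ (no comma between $i$ and $j$) and $A_{12,\,i,\,j}$ (with a comma) are different matrices. The inverse $A^{-1}$ is partitioned in the same way as $A$, and $A^{11}$, $A^{12,i}$, $A^{22,i}$, $A^{12,ij}$, $A^{12,\,i,\,j}$, $A^{22,ij}$ denote the blocks of $A^{-1}$ in the positions of $A_{11}$, $A_{12,i}$, $A_{22,i}$, $A_{12,ij}$, $A_{12,\,i,\,j}$, $A_{22,ij}$, respectively (superscripts are block labels, not powers). The solution $x$ of $Ax=a$ is partitioned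 conformably as the vertical concatenation of $x_1$ ($p\times1$) followed, for $i=1,\ldots,m$ in order, by $x_{2,i}$ ($q_1\times1$), $x_{2,i1},\ldots,x_{2,in_i}$ (each $q_2\times1$). *)

(* Defs.v *)
From mathcomp Require Import all_boot all_order all_algebra.
From mathcomp Require Export reals.

Set Implicit Arguments.
Unset Strict Implicit.
Unset Printing Implicit Defensive.

Import GRing.Theory.
Local Open Scope ring_scope.

(* As in mxdiag, conform_mx only transports M i along i = k. *)
Definition blockdiag (F : realType) (d : nat) (r s : 'I_d -> nat)
    (M : forall i, 'M[F]_(r i, s i)) :
    'M[F]_(\sum_(i < d) r i, \sum_(i < d) s i) :=
  \mxblock_(i < d, k < d) if i == k then conform_mx 0 (M i) else 0.

(* For q <= n, conform_mx is a cast along q + (n - q) = n in the next three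
   definitions.  If n < q there is no matrix [R; O] with n rows; the value is
   then the irrelevant default 0. *)
Definition pad_rows (F : realType) (n q : nat) (R : 'M[F]_q) : 'M[F]_(n, q) :=
  conform_mx 0 (col_mx R (0 : 'M[F]_(n - q, q))).

Definition first_rows (F : realType) (q n k : nat) (M : 'M[F]_(n, k)) :
    'M[F]_(q, k) :=
  usubmx (conform_mx (0 : 'M[F]_(q + (n - q), k)) M).

Definition remaining_rows (F : realType) (q n k : nat) (M : 'M[F]_(n, k)) :
    'M[F]_(n - q, k) :=
  dsubmx (conform_mx (0 : 'M[F]_(q + (n - q), k)) M).

(* is_trig_mx means lower triangular. *)
Definition qr_decomposition (F : realType) (n q : nat) (M : 'M[F]_(n, q))
    (Q : 'M[F]_n) (R : 'M[F]_q) : Prop :=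
  [/\ M = Q *m pad_rows n R,
      Q \in unitmx,
      invmx Q = Q^T
    & is_trig_mx R^T].

Definition diag_prod (F : realType) (n : nat) (M : 'M[F]_n) : F :=
  \prod_(k < n) M k k.

Definition width3 (p q1 q2 m : nat) (n : 'I_m -> nat) : nat :=
  (p + \sum_(i < m) (q1 + \sum_(j < n i) q2))%N.

Section Blocks.
Variables (F : realType) (p q1 q2 m : nat) (n : 'I_m -> nat).

Implicit Types (M : 'M[F]_(width3 p q1 q2 n)) (x : 'cV[F]_(width3 p q1 q2 n)).

(* In the names below, "ij" is the position of A_{12,ij}, A_{22,ij} (no comma
   between i and j), and "i_j" that of A_{12, i, j}. *)

Definition vec1 x : 'cV[F]_p := usubmx x.

Definition vec2_group x (i : 'I_m) : 'cV[F]_(q1 + \sum_(j < n i) q2) :=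
  submxcol (dsubmx x) i.

Definition vec2i x (i : 'I_m) : 'cV[F]_q1 := usubmx (vec2_group x i).

Definition vec2ij x (i : 'I_m) (j : 'I_(n i)) : 'cV[F]_q2 :=
  submxcol (dsubmx (vec2_group x i)) j.

Definition blk11 M : 'M[F]_p := ulsubmx M.

Definition blk12_group M (i : 'I_m) : 'M[F]_(p, q1 + \sum_(j < n i) q2) :=
  submxrow (ursubmx M) i.

Definition blk12i M (i : 'I_m) : 'M[F]_(p, q1) := lsubmx (blk12_group M i).

Definition blk12ij M (i : 'I_m) (j : 'I_(n i)) : 'M[F]_(p, q2) :=
  submxrow (rsubmx (blk12_group M i)) j.

Definition blk22_group M (i : 'I_m) : 'M[F]_(q1 + \sum_(j < n i) q2) :=
  submxblock (drsubmx M) i i.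

Definition blk22i M (i : 'I_m) : 'M[F]_q1 := ulsubmx (blk22_group M i).

Definition blk12i_j M (i : 'I_m) (j : 'I_(n i)) : 'M[F]_(q1, q2) :=
  submxrow (ursubmx (blk22_group M i)) j.

Definition blk22ij M (i : 'I_m) (j : 'I_(n i)) : 'M[F]_q2 :=
  submxblock (drsubmx (blk22_group M i)) j j.

End Blocks.

Arguments pad_rows {F} n {q} R.
Arguments first_rows {F} q {n k} M.
Arguments remaining_rows {F} q {n k} M.
Arguments width3 p q1 q2 {m} n.

(* Main.v *)
Require Import Defs.
From mathcomp Require Import all_boot all_order all_algebra.

Set Implicit Arguments.
Unset Strict Implicit.
Unset Printing Implicit Defensive.

Import GRing.Theory.
Local Open Scope ring_scope.

(** The successive QR decompositions amount to a single factorization of the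
  sparse matrix B, namely B = P L with P^T P = 1, in which the square factor L
  is block LOWER triangular for the partition of A, with the invertible upper
  triangular matrices R, Ri i, Rij i j on its diagonal: L times the vector with
  blocks x_1, x_{2,i}, x_{2,ij} has the blocks
    R x_1,
    C1 i x_1 + Ri i x_{2,i},
    D1 i j x_1 + dD1 i j x_{2,i} + Rij i j x_{2,ij}
  ([sparse_factor]).

  One elimination step explains this.  Suppose that Y = P L and that [P | N] is
  orthogonal, so P P^T + N N^T = 1.  Then any X splits as P (P^T X) + N (N^T X),
  and if N^T X = P0 R0 then [X | Y] = [N P0 | P] [R0 0; P^T X L].  The new left
  factor has orthonormal columns, and N N0 completes it as N0 completes P0
  ([thin_factor_row_mx]).  The step is applied inside each group i, then to the
  groups, the factors of the separate blocks being assembled block diagonally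
  ([level_thin_factor]).

  Hence A = B^T B = L^T L, and everything is read off L.
  - The determinant of A is (det L)^2, and det L is the product of the
    determinants of its diagonal blocks ([det_sparse_factor]); the
    full rank of B makes L, hence all these blocks, invertible
    ([sparse_factor_units]).
  - A x = B^T b is equivalent to L x = P^T b, which is solved from the top down
    ([sparse_factor_solve]); P^T b has entries c, c1 i, d1 i j.
  - If V is the inverse of A, then W = L V satisfies L^T W = 1.  As L^T is block
    upper triangular, so is W, with diagonal blocks the inverse transposes of
    those of L ([lblock_tr_inv]).  The blocks of L V on and below the diagonal
    are thereby known, and together with V^T = V they determine by back
    substitution the listed blocks of V ([sparse_factor_inv]). *)

(** * Algebra of rectangular block diagonal matrices *)

Section BlockDiag.
Variables (F : realType) (d : nat).
Implicit Types r s t : 'I_d -> nat.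

(** This rule characterizes [blockdiag M] by its action, free of the casts in
  its definition; most identities on block diagonal matrices derive from it. *)
Lemma submxcol_blockdiag_mul r s (M : forall i, 'M[F]_(r i, s i)) k
    (X : 'M[F]_(\sum_(i < d) s i, k)) i :
  submxcol (blockdiag M *m X) i = M i *m submxcol X i.
Proof.
rewrite -[X in LHS]submxcolK /blockdiag mxblockEh mul_mxrow_mxcol submxcol_sum.
rewrite [LHS](bigD1 i) //= [X in _ + X]big1 => [|j ji];
  rewrite -submxcol_mul mxcolK.
  by rewrite eqxx conform_mx_id addr0.
by rewrite eq_sym (negbTE ji) mul0mx.
Qed.

Lemma blockdiag_mul_mxcol r s (M : forall i, 'M[F]_(r i, s i)) k
    (X : forall i, 'M[F]_(s i, k)) :
  blockdiag M *m \mxcol_i X i = \mxcol_i (M i *m X i).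
Proof. by apply/mxcolP => i; rewrite submxcol_blockdiag_mul !mxcolK. Qed.

Lemma tr_blockdiag r s (M : forall i, 'M[F]_(r i, s i)) :
  (blockdiag M)^T = blockdiag (fun i => (M i)^T).
Proof.
rewrite /blockdiag tr_mxblock; apply: eq_mxblock => i j.
by rewrite eq_sym; case: eqP => [->|]; rewrite ?conform_mx_id ?trmx0.
Qed.

Lemma submxcol_blockdiag r s (M : forall i, 'M[F]_(r i, s i)) i :
  submxcol (blockdiag M) i = M i *m submxcol 1%:M i.
Proof. by rewrite -[blockdiag M]mulmx1 submxcol_blockdiag_mul. Qed.

Lemma mul_blockdiag r s t (M : forall i, 'M[F]_(r i, s i))
    (N : forall i, 'M[F]_(s i, t i)) :
  blockdiag M *m blockdiag N = blockdiag (fun i => M i *m N i).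
Proof.
apply/mxcolP => i.
by rewrite submxcol_blockdiag_mul !submxcol_blockdiag mulmxA.
Qed.

Lemma add_blockdiag r s (M N : forall i, 'M[F]_(r i, s i)) :
  blockdiag M + blockdiag N = blockdiag (fun i => M i + N i).
Proof.
by apply/mxcolP => i; rewrite submxcolD !submxcol_blockdiag mulmxDl.
Qed.

Lemma eq_blockdiag r s (M N : forall i, 'M[F]_(r i, s i)) :
  (forall i, M i = N i) -> blockdiag M = blockdiag N.
Proof. by move=> MN; apply/mxcolP => i; rewrite !submxcol_blockdiag MN. Qed.

Lemma blockdiag0 r s : blockdiag (fun i => 0 : 'M[F]_(r i, s i)) = 0.
Proof. by apply/mxcolP => i; rewrite submxcol_blockdiag mul0mx submxcol0. Qed.

Lemma blockdiag1 r : blockdiag (fun i => 1%:M : 'M[F]_(r i)) = 1%:M.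
Proof. exact: mxdiagZ. Qed.

Lemma submxblock_blockdiag_mul r s (M : forall i, 'M[F]_(r i, s i)) e
    (t : 'I_e -> nat) (X : 'M[F]_(\sum_(i < d) s i, \sum_(k < e) t k)) i k :
  submxblock (blockdiag M *m X) i k = M i *m submxblock X i k.
Proof. by rewrite !submxblockEv submxcol_blockdiag_mul -mul_submxrow. Qed.

Lemma submxrow_mul_blockdiag r s (M : forall i, 'M[F]_(r i, s i)) k
    (X : 'M[F]_(k, \sum_(i < d) r i)) i :
  submxrow (X *m blockdiag M) i = submxrow X i *m M i.
Proof.
apply: trmx_inj; rewrite tr_submxrow trmx_mul tr_blockdiag.
by rewrite submxcol_blockdiag_mul trmx_mul tr_submxrow.
Qed.

Lemma submxblock_mul_blockdiag r s (M : forall i, 'M[F]_(r i, s i)) e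
    (t : 'I_e -> nat) (X : 'M[F]_(\sum_(k < e) t k, \sum_(i < d) r i)) k i :
  submxblock (X *m blockdiag M) k i = submxblock X k i *m M i.
Proof.
by rewrite !submxblockEh submxrow_mul_blockdiag submxcol_mul.
Qed.

Lemma submxblock1 r i : submxblock (1%:M : 'M[F]_(\sum_(i < d) r i)) i i = 1%:M.
Proof. by rewrite -blockdiag1 /blockdiag mxblockK eqxx conform_mx_id. Qed.

Lemma row_full_blockdiag r s (M : forall i, 'M[F]_(r i, s i)) i :
  row_full (blockdiag M) -> row_full (M i).
Proof.
case/row_fullP => G GM; apply/row_fullP; exists (submxblock G i i).
by rewrite -submxblock_mul_blockdiag GM submxblock1.
Qed.

End BlockDiag.

Lemma det_blockdiag (F : realType) d (r : 'I_d -> nat)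
    (M : forall i, 'M[F]_(r i)) : \det (blockdiag M) = \prod_i \det (M i).
Proof.
rewrite -[blockdiag M]/(mxdiag M).
elim: d r M => [|d IHd] r M.
  by move: (mxdiag _); rewrite !big_ord0 => K; rewrite det_mx00.
rewrite mxdiag_recl [RHS]big_ord_recl -IHd.
by case: _ / mxsize_recl; rewrite castmx_id det_ublock.
Qed.

Lemma row_full_rsub (F : realType) n p q (X : 'M[F]_(n, p)) (Y : 'M[F]_(n, q)) :
  row_full (row_mx X Y) -> row_full Y.
Proof.
case/row_fullP => G GB; apply/row_fullP; exists (dsubmx G).
rewrite mul_dsub_mx -[G *m Y](row_mxKr (G *m X)) -mul_mx_row GB.
by rewrite scalar_mx_block block_mxEh row_mxKr col_mxKd.
Qed.

(** * Thin factorizations and the elimination step *)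

Section ThinFactor.
Variable F : realType.

(** The matrix [P | N] is orthogonal.  Keeping P and N apart, rather than as one
  square matrix, avoids any cast between n and q + r, and lets block assembly
  leave the columns of P and N in separate groups.  L is any square matrix
  because at the outer level it is itself a blockdiag of block factors. *)
Definition thin_factor n q r (M : 'M[F]_(n, q)) (P : 'M[F]_(n, q))
    (N : 'M[F]_(n, r)) (L : 'M[F]_q) : Prop :=
  [/\ M = P *m L, P^T *m P = 1%:M, N^T *m N = 1%:M, N^T *m P = 0
    & P *m P^T + N *m N^T = 1%:M].

Lemma thin_factor_blockdiag d (n q r : 'I_d -> nat)
    (M P : forall i, 'M[F]_(n i, q i)) (N : forall i, 'M[F]_(n i, r i))
    (L : forall i, 'M[F]_(q i)) :
  (forall i, thin_factor (M i) (P i) (N i) (L i)) ->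
  thin_factor (blockdiag M) (blockdiag P) (blockdiag N) (blockdiag L).
Proof.
move=> H; split; rewrite ?tr_blockdiag ?mul_blockdiag ?add_blockdiag.
- by apply: eq_blockdiag => i; case: (H i).
- by rewrite -blockdiag1; apply: eq_blockdiag => i; case: (H i).
- by rewrite -blockdiag1; apply: eq_blockdiag => i; case: (H i).
- by rewrite -(blockdiag0 F r q); apply: eq_blockdiag => i; case: (H i).
- by rewrite -blockdiag1; apply: eq_blockdiag => i; case: (H i).
Qed.

(** The elimination step.  Since P P^T + N N^T = 1, X is the sum of its
  projection P (P^T X) and of N (N^T X) = N P0 R0; and N, having orthonormal
  columns orthogonal to those of P, transports the orthogonality of [P0 | N0]. *)
Lemma thin_factor_row_mx n p q r s (X : 'M[F]_(n, p)) (Y P : 'M[F]_(n, q))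
    (N : 'M[F]_(n, r)) L (P0 : 'M[F]_(r, p)) (N0 : 'M[F]_(r, s)) R0 :
  thin_factor Y P N L -> thin_factor (N^T *m X) P0 N0 R0 ->
  thin_factor (row_mx X Y) (row_mx (N *m P0) P) (N *m N0)
    (block_mx R0 0 (P^T *m X) L).
Proof.
move=> [YE PP NN NP PN] [XE PP0 NN0 NP0 PN0].
have PNz : P^T *m N = 0 by apply: trmx_inj; rewrite trmx_mul trmxK NP trmx0.
split.
- rewrite mul_row_block mulmx0 add0r -YE; congr row_mx.
  by rewrite -mulmxA -XE !mulmxA -mulmxDl addrC PN mul1mx.
- rewrite tr_row_mx mul_col_row trmx_mul PP.
  rewrite -!mulmxA NP (mulmxA N^T) NN mul1mx PP0 (mulmxA P^T) PNz.
  by rewrite mulmx0 mul0mx -scalar_mx_block.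
- by rewrite trmx_mul -mulmxA (mulmxA N^T) NN mul1mx.
- rewrite trmx_mul mul_mx_row -!mulmxA NP (mulmxA N^T) NN mul1mx NP0 mulmx0.
  by rewrite row_mx0.
- rewrite tr_row_mx mul_row_col !trmx_mul addrAC -!mulmxA -mulmxDr.
  by rewrite !(mulmxA _ _ N^T) -mulmxDl PN0 mul1mx addrC PN.
Qed.

Lemma first_rows_mul n q k l (A : 'M[F]_(n, k)) (B : 'M[F]_(k, l)) :
  (q <= n)%N -> first_rows q (A *m B) = first_rows q A *m B.
Proof.
move=> /subnKC; rewrite /first_rows; move: (n - q)%N => r e.
by case: n / e A => A; rewrite !conform_mx_id mul_usub_mx.
Qed.

Lemma remaining_rows_mul n q k l (A : 'M[F]_(n, k)) (B : 'M[F]_(k, l)) :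
  (q <= n)%N -> remaining_rows q (A *m B) = remaining_rows q A *m B.
Proof.
move=> /subnKC; rewrite /remaining_rows; move: (n - q)%N => r e.
by case: n / e A => A; rewrite !conform_mx_id mul_dsub_mx.
Qed.

(** P and N are the first q and the remaining columns of Q, written so that P^T
  and N^T extract the first and remaining rows of a product by Q^T. *)
Lemma qr_thin_factor n q (M : 'M[F]_(n, q)) (Q : 'M[F]_n) (R : 'M[F]_q) :
  (q <= n)%N -> qr_decomposition M Q R ->
  thin_factor M (first_rows q Q^T)^T (remaining_rows q Q^T)^T R.
Proof.
move=> /subnKC; rewrite /qr_decomposition /pad_rows /first_rows /remaining_rows.
move: (n - q)%N => r e; case: n / e M Q => M Q.
rewrite !conform_mx_id => -[-> Qu QV _].
have QQ : Q^T *m Q = 1%:M by rewrite -QV mulVmx.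
have QQ' : Q *m Q^T = 1%:M by rewrite -QV mulmxV.
rewrite -trmx_lsub -trmx_rsub !trmxK.
move: (lsubmx Q) (rsubmx Q) (esym (hsubmxK Q)) QQ QQ' => P N ->.
rewrite tr_row_mx mul_col_row !mul_row_col mulmx0 addr0 => + PPNN.
by rewrite scalar_mx_block => /eq_block_mx[PP _ NP NN]; split.
Qed.

End ThinFactor.

(** * Elimination for a stack of independent blocks *)

Section StackedLevel.
Variables (F : realType) (d : nat) (n q r : 'I_d -> nat).
Variables (P : forall i, 'M[F]_(n i, q i)) (N : forall i, 'M[F]_(n i, r i)).

Definition level_basis p (P0 : 'M[F]_(\sum_(i < d) r i, p)) :=
  row_mx (blockdiag N *m P0) (blockdiag P).

Definition level_complement s (N0 : 'M[F]_(\sum_(i < d) r i, s)) :=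
  blockdiag N *m N0.

Lemma tr_level_basis_mul p (P0 : 'M[F]_(\sum_(i < d) r i, p)) k
    (Z : forall i, 'M[F]_(n i, k)) :
  (level_basis P0)^T *m \mxcol_i Z i =
  col_mx (P0^T *m \mxcol_i ((N i)^T *m Z i)) (\mxcol_i ((P i)^T *m Z i)).
Proof.
rewrite tr_row_mx mul_col_mx trmx_mul !tr_blockdiag -mulmxA.
by rewrite !blockdiag_mul_mxcol.
Qed.

Lemma tr_level_complement_mul s (N0 : 'M[F]_(\sum_(i < d) r i, s)) k
    (Z : forall i, 'M[F]_(n i, k)) :
  (level_complement N0)^T *m \mxcol_i Z i
  = N0^T *m \mxcol_i ((N i)^T *m Z i).
Proof. by rewrite trmx_mul tr_blockdiag -mulmxA blockdiag_mul_mxcol. Qed.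

(** The elimination step applied to the block diagonal assembly of the
  factorizations of the [Y i]. *)
Lemma level_thin_factor p s (X : forall i, 'M[F]_(n i, p))
    (Y : forall i, 'M[F]_(n i, q i)) (L : forall i, 'M[F]_(q i))
    (P0 : 'M[F]_(\sum_(i < d) r i, p)) (N0 : 'M[F]_(\sum_(i < d) r i, s)) R0 :
  (forall i, thin_factor (Y i) (P i) (N i) (L i)) ->
  thin_factor (\mxcol_i ((N i)^T *m X i)) P0 N0 R0 ->
  thin_factor (row_mx (\mxcol_i X i) (blockdiag Y))
    (level_basis P0) (level_complement N0)
    (block_mx R0 0 (\mxcol_i ((P i)^T *m X i)) (blockdiag L)).
Proof.
move=> /thin_factor_blockdiag YL; rewrite -!blockdiag_mul_mxcol -!tr_blockdiag.
exact: thin_factor_row_mx YL.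
Qed.

End StackedLevel.

(** * Block lower triangular factors *)

Section LowerBlock.
Variable F : realType.

(** W inverts a block upper triangular matrix, hence is block upper triangular. *)
Lemma lblock_tr_inv p s (R : 'M[F]_p) (C : 'M[F]_(s, p)) (D : 'M[F]_s)
    (W : 'M[F]_(p + s)) :
  (block_mx R 0 C D)^T *m W = 1%:M ->
  [/\ R^T *m ulsubmx W = 1%:M, dlsubmx W = 0 & D^T *m drsubmx W = 1%:M].
Proof.
rewrite tr_block_mx -{1}[W]submxK mulmx_block scalar_mx_block trmx0.
rewrite !mul0mx !add0r => /eq_block_mx[RW _ DW DW1].
have Du : D^T \in unitmx by case/mulmx1_unit: DW1.
have W0 : dlsubmx W = 0 by rewrite -[LHS](mulKmx Du) DW mulmx0.
by split=> //; move: RW; rewrite W0 mulmx0 addr0.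
Qed.

Lemma lblock_mul p s k l (R : 'M[F]_p) (C : 'M[F]_(s, p)) (D : 'M[F]_s)
    (V : 'M[F]_(p + s, k + l)) :
  [/\ ulsubmx (block_mx R 0 C D *m V) = R *m ulsubmx V,
      dlsubmx (block_mx R 0 C D *m V) = C *m ulsubmx V + D *m dlsubmx V
    & drsubmx (block_mx R 0 C D *m V) = C *m ursubmx V + D *m drsubmx V].
Proof.
rewrite -{1 3 6}[V]submxK mulmx_block !mul0mx !addr0.
by rewrite block_mxKul block_mxKdl block_mxKdr.
Qed.

End LowerBlock.

Lemma back_substitution (F : realType) q k (R : 'M[F]_q)
    (C X E : 'M[F]_(q, k)) :
  R \in unitmx -> C + R *m X = E -> X = invmx R *m (E - C).
Proof. by move=> Ru <-; rewrite addrC addKr mulKmx. Qed.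

Lemma gram_back_substitution (F : realType) q (R C X : 'M[F]_q) :
  R \in unitmx -> R^T *m (C + R *m X) = 1%:M ->
  X = invmx R *m ((invmx R)^T - C).
Proof.
move=> Ru E; apply: back_substitution => //.
by rewrite trmx_inv -[RHS]mulmx1 -E mulKmx ?unitmx_tr.
Qed.

(** * The three-level sparse factor *)

Section SparseFactor.
Variables (F : realType) (m p q1 q2 : nat) (n : 'I_m -> nat).
Variables (R : 'M[F]_p) (C1 : 'I_m -> 'M[F]_(q1, p)) (Ri : 'I_m -> 'M[F]_q1).
Variables (D1 : forall i, 'I_(n i) -> 'M[F]_(q2, p)).
Variables (dD1 : forall i, 'I_(n i) -> 'M[F]_(q2, q1)).
Variables (Rij : forall i, 'I_(n i) -> 'M[F]_q2).

Definition group_factor i : 'M[F]_(q1 + \sum_(j < n i) q2) :=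
  block_mx (Ri i) 0 (\mxcol_j dD1 j) (blockdiag (@Rij i)).

Definition sparse_factor : 'M[F]_(width3 p q1 q2 n) :=
  block_mx R 0 (\mxcol_i col_mx (C1 i) (\mxcol_j D1 j))
    (blockdiag group_factor).

Lemma det_sparse_factor :
  \det sparse_factor =
    \det R * \prod_i (\det (Ri i) * \prod_j \det (@Rij i j)).
Proof.
rewrite det_lblock det_blockdiag; congr (_ * _); apply: eq_bigr => i _.
by rewrite det_lblock det_blockdiag.
Qed.

Lemma sparse_factor_units :
  sparse_factor \in unitmx ->
  [/\ R \in unitmx, forall i, Ri i \in unitmx
    & forall i j, @Rij i j \in unitmx].
Proof.
rewrite !unitmxE det_sparse_factor unitrM => /andP[-> /unitr_prodP H].
split=> // i => [|j]; have := H i (mem_index_enum _) isT;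
  rewrite unitrM unitmxE => /andP[] //.
by move=> _ /unitr_prodP/(_ j (mem_index_enum _) isT).
Qed.

Lemma sparse_factor_solve x y c1 d1 :
  sparse_factor *m x =
    col_mx y (\mxcol_i col_mx (c1 i) (\mxcol_j d1 i j)) ->
  [/\ R *m vec1 x = y,
      forall i, C1 i *m vec1 x + Ri i *m vec2i x i = c1 i
    & forall i j, D1 j *m vec1 x + dD1 j *m vec2i x i + Rij j *m vec2ij x j
        = d1 i j].
Proof.
rewrite /sparse_factor -{1}[x]vsubmxK mul_block_col mul0mx addr0.
case/eq_col_mx => Rx rest.
have {}rest i : col_mx (C1 i) (\mxcol_j @D1 i j) *m vec1 x
    + group_factor i *m vec2_group x i = col_mx (c1 i) (\mxcol_j d1 i j).
  rewrite -[RHS](mxcolK (fun i => col_mx (c1 i) (\mxcol_j d1 i j)) i) -rest.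
  rewrite submxcolD submxcol_blockdiag_mul.
  by rewrite -submxcol_mul mxcolK.
split=> // i => [|j]; have := rest i; rewrite /group_factor;
  rewrite -{1}[vec2_group x i]vsubmxK mul_col_mx mul_block_col mul0mx addr0;
  rewrite add_col_mx => /eq_col_mx[ci di] //.
rewrite -[RHS](mxcolK (d1 i) j) -di !submxcolD submxcol_blockdiag_mul.
by rewrite -!submxcol_mul !mxcolK addrA.
Qed.

(** With V the inverse of A = L^T L, the left-hand sides below are the blocks of
  L V, which is the inverse transpose of L and so is block upper triangular:
  they vanish below the diagonal and are inverse transposes on it.  The
  symmetry of V turns its blocks below the diagonal into transposes of the
  named ones. *)
Lemma sparse_factor_inv V :
  sparse_factor^T *m (sparse_factor *m V) = 1%:M -> V^T = V ->
  [/\ R^T *m (R *m blk11 V) = 1%:M,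
      forall i, C1 i *m blk11 V + Ri i *m (blk12i V i)^T = 0
        /\ (Ri i)^T *m (C1 i *m blk12i V i + Ri i *m blk22i V i) = 1%:M
    & forall i (j : 'I_(n i)),
      [/\ D1 j *m blk11 V + dD1 j *m (blk12i V i)^T
            + Rij j *m (blk12ij V j)^T = 0,
          D1 j *m blk12i V i + dD1 j *m blk22i V i
            + Rij j *m (blk12i_j V j)^T = 0
        & (Rij j)^T *m (D1 j *m blk12ij V j + dD1 j *m blk12i_j V j
            + Rij j *m blk22ij V j) = 1%:M]].
Proof.
move=> + Vsym.
have V21 i : (blk12_group V i)^T = submxcol (dlsubmx V) i.
  by rewrite tr_submxrow trmx_ursub Vsym.
have V22 i : (blk22_group V i)^T = blk22_group V i.
  by rewrite tr_submxblock trmx_drsub Vsym.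
case/lblock_tr_inv; case: (lblock_mul R (\mxcol_i col_mx (C1 i) (\mxcol_j D1 j))
  (blockdiag group_factor) V) => -> -> -> R11 E21 E22.
have {}E21 i : col_mx (C1 i) (\mxcol_j @D1 i j) *m blk11 V
    + group_factor i *m (blk12_group V i)^T = 0.
  rewrite V21 -submxcol_blockdiag_mul.
  rewrite -[X in X *m _](mxcolK (fun i => col_mx (C1 i) (\mxcol_j @D1 i j)) i).
  rewrite submxcol_mul.
  by rewrite -submxcolD E21 submxcol0.
have {}E22 i : (group_factor i)^T *m (col_mx (C1 i) (\mxcol_j @D1 i j)
    *m blk12_group V i + group_factor i *m blk22_group V i) = 1%:M.
  rewrite -(@submxblock1 F m (fun i => q1 + \sum_(j < n i) q2)%N i) -E22.
  rewrite tr_blockdiag submxblock_blockdiag_mul.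
  congr (_ *m _).
  rewrite submxblockD submxblock_blockdiag_mul submxblockEh; congr (_ + _).
  by rewrite -mul_submxrow -submxcol_mul mxcolK.
have E12 i : [/\ C1 i *m blk11 V + Ri i *m (blk12i V i)^T = 0 &
  forall j : 'I_(n i), D1 j *m blk11 V + dD1 j *m (blk12i V i)^T
            + Rij j *m (blk12ij V j)^T = 0].
  have := E21 i; rewrite /group_factor -[blk12_group V i]hsubmxK.
  rewrite tr_row_mx mul_col_mx mul_block_col mul0mx addr0 add_col_mx.
  rewrite -[0]col_mx0 => /eq_col_mx[-> d]; split=> // j.
  have := congr1 (fun X => submxcol X j) d; rewrite submxcol0 !submxcolD.
  by rewrite submxcol_blockdiag_mul -!submxcol_mul !mxcolK addrA tr_submxrow.
have E22' i :
  [/\ (Ri i)^T *m (C1 i *m blk12i V i + Ri i *m blk22i V i) = 1%:M,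
      forall j : 'I_(n i), D1 j *m blk12i V i + dD1 j *m blk22i V i
            + Rij j *m (blk12i_j V j)^T = 0
    & forall j, (Rij j)^T *m (D1 j *m blk12ij V j + dD1 j *m blk12i_j V j
            + @Rij i j *m blk22ij V j) = 1%:M].
  have := E22 i; rewrite /group_factor => /lblock_tr_inv.
  rewrite -[blk12_group V i]hsubmxK -[blk22_group V i]submxK.
  rewrite mul_col_row mulmx_block !mul0mx !addr0 add_block_mx.
  rewrite block_mxKul block_mxKdl block_mxKdr => -[-> d e]; split=> // j.
    have := congr1 (fun X => submxcol X j) d; rewrite submxcol0 !submxcolD.
    rewrite submxcol_blockdiag_mul -!submxcol_mul !mxcolK addrA.
    by rewrite tr_submxrow trmx_ursub V22.
  rewrite -(@submxblock1 F (n i) (fun=> q2) j) -e tr_blockdiag.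
  rewrite submxblock_blockdiag_mul; congr (_ *m _).
  rewrite !submxblockD submxblock_blockdiag_mul !(submxblockEh (_ *m _)) addrA.
  by rewrite -!mul_submxrow -!submxcol_mul !mxcolK.
split=> // i => [|j]; case: (E12 i) (E22' i) => [e1 e2] [e3 e4 e5].
  by split.
by split; [apply: e2|apply: e4|apply: e5].
Qed.

End SparseFactor.

(** * The sparse least squares solution *)

Theorem theorem4 (F : realType) (m p q1 q2 : nat) (n : 'I_m -> nat)
  (o : forall i : 'I_m, 'I_(n i) -> nat)
  (m_gt0 : (0 < m)%N) (p_gt0 : (0 < p)%N)
  (q1_gt0 : (0 < q1)%N) (q2_gt0 : (0 < q2)%N)
  (n_gt0 : forall i, (0 < n i)%N) (o_gt0 : forall i j, (0 < o i j)%N)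
  (Bij : forall i j, 'M[F]_(o i j, p))
  (dBij : forall i j, 'M[F]_(o i j, q1))
  (ddBij : forall i j, 'M[F]_(o i j, q2))
  (bij : forall i j, 'cV[F]_(o i j))
  (Qij : forall i j, 'M[F]_(o i j)) (Rij : forall i (j : 'I_(n i)), 'M[F]_q2)
  (Qi : forall i : 'I_m, 'M[F]_(\sum_(j < n i) (o i j - q2)))
  (Ri : forall i : 'I_m, 'M[F]_q1)
  (Q : 'M[F]_(\sum_(i < m) (\sum_(j < n i) (o i j - q2) - q1)))
  (R : 'M[F]_p) :
  let B : 'M[F]_(\sum_(i < m) \sum_(j < n i) o i j, width3 p q1 q2 n) :=
    row_mx (\mxcol_(i < m) \mxcol_(j < n i) Bij i j)
           (blockdiag (fun i : 'I_m =>
              row_mx (\mxcol_(j < n i) dBij i j)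
                     (blockdiag (fun j : 'I_(n i) => ddBij i j)))) in
  let b : 'cV[F]_(\sum_(i < m) \sum_(j < n i) o i j) :=
    \mxcol_(i < m) \mxcol_(j < n i) bij i j in
  let A := B^T *m B in
  let a := B^T *m b in
  \rank B = width3 p q1 q2 n ->
  (* step 1(a) *)
  (forall i j, qr_decomposition (ddBij i j) (Qij i j) (Rij i j)) ->
  let d0 i j := (Qij i j)^T *m bij i j in
  let D0 i j := (Qij i j)^T *m Bij i j in
  let dD0 i j := (Qij i j)^T *m dBij i j in
  let d1 i j := first_rows q2 (d0 i j) in
  let D1 i j := first_rows q2 (D0 i j) in
  let dD1 i j := first_rows q2 (dD0 i j) in
  let d2 i j := remaining_rows q2 (d0 i j) in
  let D2 i j := remaining_rows q2 (D0 i j) in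
  let dD2 i j := remaining_rows q2 (dD0 i j) in
  (* step 1(b) *)
  (forall i, qr_decomposition (\mxcol_(j < n i) dD2 i j) (Qi i) (Ri i)) ->
  let c0 i := (Qi i)^T *m \mxcol_(j < n i) d2 i j in
  let C0 i := (Qi i)^T *m \mxcol_(j < n i) D2 i j in
  let c1 i := first_rows q1 (c0 i) in
  let C1 i := first_rows q1 (C0 i) in
  let c2 i := remaining_rows q1 (c0 i) in
  let C2 i := remaining_rows q1 (C0 i) in
  (* step 2 *)
  qr_decomposition (\mxcol_(i < m) C2 i) Q R ->
  let c := first_rows p (Q^T *m \mxcol_(i < m) c2 i) in
  let V := invmx A in
  (* every inverse occurring below exists *)
  [/\ A \in unitmx, R \in unitmx, (forall i, Ri i \in unitmx)
    & forall i j, Rij i j \in unitmx] /\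
  (* the solution of A x = a *)
  (forall x : 'cV[F]_(width3 p q1 q2 n), A *m x = a ->
    [/\ vec1 x = invmx R *m c,
        forall i, vec2i x i = invmx (Ri i) *m (c1 i - C1 i *m vec1 x)
      & forall i j, vec2ij x j =
          invmx (Rij i j)
            *m (d1 i j - D1 i j *m vec1 x - dD1 i j *m vec2i x i)]) /\
  (* the sub-blocks of the inverse of A *)
  blk11 V = invmx R *m (invmx R)^T /\
  (forall i,
    blk12i V i = - (blk11 V *m (invmx (Ri i) *m C1 i)^T) /\
    blk22i V i = invmx (Ri i) *m ((invmx (Ri i))^T - C1 i *m blk12i V i)) /\
  (forall i (j : 'I_(n i)),
    [/\ blk12ij V j =
          - (invmx (Rij i j)
               *m (D1 i j *m blk11 V + dD1 i j *m (blk12i V i)^T))^T,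
        blk12i_j V j =
          - (invmx (Rij i j)
               *m (D1 i j *m blk12i V i + dD1 i j *m blk22i V i))^T
      & blk22ij V j =
          invmx (Rij i j)
            *m ((invmx (Rij i j))^T - D1 i j *m blk12ij V j
                - dD1 i j *m blk12i_j V j)]) /\
  (* the determinant of A *)
  \det A =
    (diag_prod R *
       \prod_(i < m) (diag_prod (Ri i) *
                        \prod_(j < n i) diag_prod (Rij i j))) ^+ 2.
Proof.
move=> B b A a Brank Qij_qr d0 D0 dD0 d1 D1 dD1 d2 D2 dD2 Qi_qr.
move=> c0 C0 c1 C1 c2 C2 Q_qr c V.
(* Full column rank passes to the blocks of the block diagonal part of B, which
   are therefore at least as tall as wide: this is what makes all the splittings
   into first and remaining rows genuine. *)
have Bfull : row_full B by rewrite /row_full Brank.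
have B2full i := row_full_blockdiag i (row_full_rsub Bfull).
have le_ij i j : (q2 <= o i j)%N.
  have /eqP <- := row_full_blockdiag j (row_full_rsub (B2full i)).
  exact: rank_leq_row.
(* At the outer levels, a decomposed stack has lost exactly as many rows as the
   columns already eliminated, so the bound on B or on a group gives its own. *)
have size_i i : (\sum_(j < n i) (o i j - q2) + \sum_(j < n i) q2
    = \sum_(j < n i) o i j)%N.
  by rewrite -big_split; apply: eq_bigr => j _; rewrite /= subnK.
have le_i i : (q1 <= \sum_(j < n i) (o i j - q2))%N.
  rewrite -(leq_add2r (\sum_(j < n i) q2)) size_i.
  have /eqP <- := B2full i; exact: rank_leq_row.
have le_p : (p <= \sum_(i < m) (\sum_(j < n i) (o i j - q2) - q1))%N.
  rewrite -(leq_add2r (\sum_(i < m) (q1 + \sum_(j < n i) q2))).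
  rewrite -[X in (X <= _)%N]Brank; apply: leq_trans (rank_leq_row _) _.
  rewrite -big_split; apply: leq_sum => i _ /=.
  by rewrite addnA (subnK (le_i i)) size_i.
pose Pij i j := (first_rows q2 (Qij i j)^T)^T.
pose Nij i j := (remaining_rows q2 (Qij i j)^T)^T.
pose Pi i := (first_rows q1 (Qi i)^T)^T.
pose Ni i := (remaining_rows q1 (Qi i)^T)^T.
pose P := (first_rows p Q^T)^T.
pose N := (remaining_rows p Q^T)^T.
have d1E i j : d1 i j = (Pij i j)^T *m bij i j.
  by rewrite trmxK -first_rows_mul.
have d2E i j : d2 i j = (Nij i j)^T *m bij i j.
  by rewrite trmxK -remaining_rows_mul.
have D1E i j : D1 i j = (Pij i j)^T *m Bij i j.
  by rewrite trmxK -first_rows_mul.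
have D2E i j : D2 i j = (Nij i j)^T *m Bij i j.
  by rewrite trmxK -remaining_rows_mul.
have dD1E i j : dD1 i j = (Pij i j)^T *m dBij i j.
  by rewrite trmxK -first_rows_mul.
have dD2E i j : dD2 i j = (Nij i j)^T *m dBij i j.
  by rewrite trmxK -remaining_rows_mul.
have c1E i : c1 i = (Pi i)^T *m \mxcol_(j < n i) d2 i j.
  by rewrite trmxK -first_rows_mul.
have c2E i : c2 i = (Ni i)^T *m \mxcol_(j < n i) d2 i j.
  by rewrite trmxK -remaining_rows_mul.
have C1E i : C1 i = (Pi i)^T *m \mxcol_(j < n i) D2 i j.
  by rewrite trmxK -first_rows_mul.
have C2E i : C2 i = (Ni i)^T *m \mxcol_(j < n i) D2 i j.
  by rewrite trmxK -remaining_rows_mul.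
have cE : c = P^T *m \mxcol_(i < m) c2 i.
  by rewrite trmxK -first_rows_mul.
pose Pgroup i := level_basis (Pij i) (Nij i) (Pi i).
pose Ngroup i := level_complement (Nij i) (Ni i).
pose Pall := level_basis Pgroup Ngroup P.
pose L := sparse_factor R C1 Ri D1 dD1 Rij.
have group_basisE k (Z : forall i (j : 'I_(n i)), 'M[F]_(o i j, k)) i :
    (Pgroup i)^T *m \mxcol_j Z i j = col_mx
      ((Pi i)^T *m \mxcol_j ((Nij i j)^T *m Z i j))
      (\mxcol_j ((Pij i j)^T *m Z i j)).
  exact: tr_level_basis_mul.
have group_complE k (Z : forall i (j : 'I_(n i)), 'M[F]_(o i j, k)) i :
    (Ngroup i)^T *m \mxcol_j Z i j =
      (Ni i)^T *m \mxcol_j ((Nij i j)^T *m Z i j).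
  exact: tr_level_complement_mul.
have BL : thin_factor B Pall (level_complement Ngroup N) L.
  have -> : L = block_mx R 0
      (\mxcol_i ((Pgroup i)^T *m \mxcol_j Bij i j))
      (blockdiag (group_factor Ri dD1 Rij)).
    congr block_mx; apply: eq_mxcol => i; rewrite group_basisE C1E.
    by congr (col_mx (_ *m _) _); apply: eq_mxcol => j; rewrite ?D1E ?D2E.
  apply: level_thin_factor => [i|].
    rewrite /group_factor (eq_mxcol (dD1E i)).
    apply: level_thin_factor => [j|]; first exact: qr_thin_factor.
    by rewrite -(eq_mxcol (dD2E i)); apply: qr_thin_factor.
  suff -> : \mxcol_i ((Ngroup i)^T *m \mxcol_j Bij i j) = \mxcol_i C2 i.
    exact: qr_thin_factor.
  by apply: eq_mxcol => i; rewrite group_complE C2E -(eq_mxcol (D2E i)).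
have Pb : Pall^T *m b =
    col_mx c (\mxcol_i col_mx (c1 i) (\mxcol_j d1 i j)).
  rewrite /Pall /b tr_level_basis_mul cE; congr (col_mx (_ *m _) _).
    by apply: eq_mxcol => i; rewrite group_complE c2E -(eq_mxcol (d2E i)).
  apply: eq_mxcol => i; rewrite group_basisE c1E -(eq_mxcol (d2E i)).
  by rewrite -(eq_mxcol (d1E i)).
case: BL => BE PP _ _ _.
have AE : A = L^T *m L.
  by rewrite /A BE trmx_mul -mulmxA (mulmxA Pall^T) PP mul1mx.
(* B = P L bounds the rank of B, which is the order of L, by that of L. *)
have Lu : L \in unitmx.
  rewrite -row_full_unit /row_full eqn_leq rank_leq_col -[X in (X <= _)%N]Brank.
  by rewrite BE mxrankM_maxr.
have [Ru Riu Riju] := sparse_factor_units Lu.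
have Au : A \in unitmx by rewrite AE unitmx_mul unitmx_tr Lu.
have Vsym : V^T = V by rewrite trmx_inv trmx_mul trmxK.
have LV : L^T *m (L *m V) = 1%:M by rewrite mulmxA -AE mulmxV.
have [V11 Vi Vij] := sparse_factor_inv LV Vsym.
split; first by split.
split.
  move=> x Ax; have {Ax} Lx : L *m x = Pall^T *m b.
    apply: (can_inj (mulKmx (_ : L^T \in unitmx))); first by rewrite unitmx_tr.
    by rewrite mulmxA -AE Ax /a BE trmx_mul mulmxA.
  move: Lx; rewrite Pb => /sparse_factor_solve[x1 x2 x3]; split=> [|i|i j].
  - by rewrite -x1 mulKmx.
  - exact: back_substitution (x2 i).
  - by rewrite -addrA -opprD; apply: back_substitution (x3 i j).
split.
  move: V11; rewrite -[R *m _]add0r => /(gram_back_substitution Ru) ->.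
  by rewrite subr0.
split.
  move=> i; have [e1 /(gram_back_substitution (Riu i)) e2] := Vi i; split=> //.
  rewrite -[LHS]trmxK (back_substitution (Riu i) e1) sub0r mulmxN linearN /=.
  by rewrite mulmxA trmx_mul trmx_ulsub Vsym.
split.
  move=> i j; have [e1 e2 e3] := Vij i j; split.
  - rewrite -[LHS]trmxK (back_substitution (Riju i j) e1) sub0r mulmxN.
    by rewrite linearN.
  - rewrite -[LHS]trmxK (back_substitution (Riju i j) e2) sub0r mulmxN.
    by rewrite linearN.
  - by rewrite -addrA -opprD; apply: gram_back_substitution.
have det_qr k l (M : 'M[F]_(k, l)) QM RM :
    qr_decomposition M QM RM -> \det RM = diag_prod RM.
  case=> _ _ _ RMtrig; rewrite -det_tr det_trig //.
  by apply: eq_bigr => ? _; rewrite mxE.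
rewrite AE det_mulmx det_tr -expr2 det_sparse_factor (det_qr _ _ _ _ _ Q_qr).
congr ((_ * _) ^+ 2); apply: eq_bigr => i _.
rewrite (det_qr _ _ _ _ _ (Qi_qr i)).
by congr (_ * _); apply: eq_bigr => j _; apply: det_qr (Qij_qr i j).
Qed.
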